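(* Let $0<a<b$ be real numbers, let $r$ be a positive integer, and let $f$ be a real valued function such that $f^{(r+1)}$ exists and is continuous in some open interval containing $[a,b]$ and has no zeros in $[a,b]$. Let $P_{c}$ denote the Taylor polynomial to $f$ of order $r$ at $x=c$. (i) Suppose that $r$ is odd and let $s=\frac{r-1}{2}$. Then $P_{b}-P_{a}$ has precisely one real zero $x_{0}$, and $r-1$ nonreal zeros (counted with multiplicity) $z_{1},\bar{z}_{1},\ldots,z_{s},\bar{z}_{s}$, and $$\frac{x_{0}+\sum_{k=1}^{s}2\operatorname{Re}z_{k}}{r}=\frac{\int_{a}^{b}t f^{(r+1)}(t)\,dt}{\int_{a}^{b}f^{(r+1)}(t)\,dt}.$$ (ii) Suppose that $r$ is even and let $s=\frac{r}{2}$. Then $P_{b}-P_{a}$ has only nonreal zeros (counted with multiplicity) $z_{1},\bar{z}_{1},\ldots,z_{s},\bar{z}_{s}$, and $$\frac{\sum_{k=1}^{s}2\operatorname{Re}z_{k}}{r}=\frac{\int_{a}^{b}t f^{(r+1)}(t)\,dt}{\int_{a}^{b}f^{(r+1)}(t)\,dt}.$$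
   Context: The Taylor polynomial to $f$ of order $r$ at $c$ is $P_c(z)=\sum_{k=0}^{r}\frac{f^{(k)}(c)}{k!}(z-c)^k$, regarded as a polynomial in the complex variable $z$. *)

(* Defs.v *)
From mathcomp Require Export all_boot all_order all_algebra.
From mathcomp Require Export all_classical all_reals all_analysis.
From mathcomp Require Export complex.
Export Order.TTheory GRing.Theory Num.Theory.
Export numFieldNormedType.Exports.

Set Implicit Arguments.
Unset Strict Implicit.
Unset Printing Implicit Defensive.

Local Open Scope ring_scope.
Local Open Scope classical_set_scope.
Local Open Scope complex_scope.

Definition taylor_poly (R : realType) (f : R -> R) (r : nat) (c : R) :
    {poly R[i]} :=
  \sum_(k < r.+1) (f^`(k)%classic c / k`!%:R)%:C *: ('X - (c%:C)%:P) ^+ k.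

(* [mup w 0 = 0], so without [p != 0] the zero polynomial would count as having
   no zeros. *)
Definition zeros_with_multiplicity (F : fieldType) (p : {poly F}) (s : seq F) :
    Prop :=
  p != 0 /\ forall w : F, mup w p = count_mem w s.

Definition conj_pairs (R : realType) (s : nat) (z : 'I_s -> R[i]) : seq R[i] :=
  flatten [seq [:: z k; (z k)^*] | k : 'I_s].

(* Main.v *)
(** For fixed [x], the value at [x] of the Taylor polynomial of order [r] at
    [c] has derivative [f^(r+1)(c) (x - c)^r / r!] in [c]. For even [r] this
    keeps the sign of [f^(r+1)], so [P_b(x) <> P_a(x)] for all real [x]. For odd
    [r], the derivative of [P_b - P_a] in [x] is the same difference for [f'] at
    the even order [r - 1]; hence by Rolle [P_b - P_a] has at most one real
    zero, a simple one, and it has one because nonreal zeros come in conjugate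
    pairs. The sum of the zeros is given by Vieta, the two leading coefficients
    being [(int f^(r+1)) / r!] and [- (int t f^(r+1)) / (r-1)!]. *)
Require Import Defs.
From mathcomp Require Import ring lra.
From mathcomp Require polyrcf.

Set Implicit Arguments.
Unset Strict Implicit.
Unset Printing Implicit Defensive.

Local Open Scope ring_scope.
Local Open Scope classical_set_scope.
Local Open Scope complex_scope.

(** * Real polynomials over the complex numbers: conjugate pairs of zeros and Vieta *)

Lemma count_mem_filter (T : eqType) (a : pred T) (s : seq T) (w : T) :
  count_mem w [seq y <- s | a y] = (a w * count_mem w s)%N.
Proof.
elim: s => [|y s IHs] /=; first by rewrite muln0.
rewrite (fun_if (count_mem w)) /= IHs mulnDr.
by case: (y =P w) => [->|_]; [case: (a w)|case: (a y)]; rewrite ?muln0.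
Qed.

(** List version of [conj_pairs], usable before the number of pairs is known. *)
Definition with_conj (R : rcfType) (h : seq R[i]) : seq R[i] :=
  flatten [seq [:: z; z^*] | z <- h].

Lemma count_mem_with_conj (R : rcfType) (h : seq R[i]) (w : R[i]) :
  count_mem w (with_conj h) = (count_mem w h + count_mem (w^*) h)%N.
Proof.
rewrite /with_conj; elim: h => [//|z h IHh] /=; rewrite IHh.
by rewrite -(inj_eq (can_inj (@conjcK R)) z (w^*)) conjcK; ring.
Qed.

Lemma size_with_conj (R : rcfType) (h : seq R[i]) :
  size (with_conj h) = (size h).*2.
Proof. by rewrite /with_conj; elim: h => //= z h ->. Qed.

(** Conjugation fixes the coefficients of [p], so the conjugated list of roots yields the same
    product of linear factors; comparing multiplicities in the two products gives the claim. *)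
Lemma count_mem_roots_conj (R : rcfType) (p : {poly R}) (rs : seq R[i]) :
  p != 0 ->
  map_poly (real_complex R) p =
    (lead_coef p)%:C *: \prod_(z <- rs) ('X - z%:P) ->
  forall w, count_mem (w^*) rs = count_mem w rs.
Proof.
move=> p0 E w.
have l0 : (lead_coef p)%:C != 0 by rewrite fmorph_eq0 lead_coef_eq0.
have : map_poly (@conjc R) (map_poly (real_complex R) p) =
    map_poly (real_complex R) p.
  by rewrite -map_poly_comp; apply: eq_map_poly => x /=; rewrite oppr0.
rewrite E map_polyZ /= oppr0 => /(scalerI l0).
rewrite -(prod_map_poly (@conjc R) rs predT) => H.
rewrite -mu_prod_XsubC -H mu_prod_XsubC count_map; apply: eq_count => z /=.
by rewrite (inj_eq (can_inj (@conjcK R))).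
Qed.

(** Split a list of complex roots by the sign of the imaginary part: [xs] comes from the real ones,
    [h] keeps those in the upper half plane, and conjugation symmetry accounts for the lower
    half. *)
Lemma real_poly_factor (R : rcfType) (p : {poly R}) : p != 0 ->
  exists (xs : seq R) (h : seq R[i]),
    all (fun z => complex.Im z != 0) h /\
    map_poly (real_complex R) p = (lead_coef p)%:C *:
      \prod_(w <- [seq x%:C | x <- xs] ++ with_conj h) ('X - w%:P).
Proof.
move=> p0.
have [rs] := closed_field_poly_normal (map_poly (real_complex R) p).
rewrite lead_coef_map => E.
exists [seq complex.Re z | z <- rs & complex.Im z == 0].
exists [seq z <- rs | 0 < complex.Im z]; split.
  by apply/allP => z; rewrite mem_filter => /andP[/lt0r_neq0].
rewrite E; congr (_ *: _); apply: perm_big; apply/allP => w _ /=.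
rewrite count_cat count_mem_with_conj !count_mem_filter.
rewrite (count_mem_roots_conj p0 E).
rewrite -map_comp map_id_in; last first.
  by move=> [u v]; rewrite mem_filter /= => /andP[/eqP -> _].
rewrite count_mem_filter; case: w => u v /=; rewrite oppr_gt0.
(* For each sign of the imaginary part, exactly one of the three counts survives. *)
by case: (ltgtP v 0); rewrite ?mul1n ?mul0n ?addn0 ?add0n.
Qed.

Lemma mem_with_conj_Im (R : rcfType) (h : seq R[i]) (w : R[i]) :
  all (fun z => complex.Im z != 0) h -> w \in with_conj h ->
  complex.Im w != 0.
Proof.
move=> /allP hI /flatten_mapP[z /hI zI].
by rewrite !inE => /orP[] /eqP -> //; case: z zI => u v /=; rewrite oppr_eq0.
Qed.

Lemma sum_with_conj (R : rcfType) (h : seq R[i]) :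
  \sum_(w <- with_conj h) w = (\sum_(z <- h) 2 * complex.Re z)%:C.
Proof.
rewrite /with_conj big_flatten big_map /= raddf_sum /=.
apply: eq_bigr => z _; rewrite big_cons big_seq1 addcJ.
by rewrite rmorphM rmorph_nat.
Qed.

Lemma conj_pairs_nth (R : realType) (s : nat) (h : seq R[i]) :
  size h = s -> conj_pairs (fun k : 'I_s => h`_k) = with_conj h.
Proof.
move=> <-; rewrite /conj_pairs /with_conj; congr flatten.
rewrite -[in RHS](mkseq_nth 0 h) /mkseq -val_enum_ord -!map_comp /=.
by rewrite /image_mem enumT; apply: eq_map.
Qed.

(** In the monic product the coefficient below the leading one is minus the sum of the roots; the
    quotient removes the factor [l]. Nonemptiness of [s] makes [(size s).-1] really the index below
    the top. *)
Lemma Vieta_sum_roots (F : fieldType) (p : {poly F}) (l : F) (s : seq F) :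
  (0 < size s)%N -> l != 0 -> p = l *: \prod_(w <- s) ('X - w%:P) ->
  \sum_(w <- s) w = - p`_(size s).-1 / p`_(size s).
Proof.
move=> s0 l0 ->; rewrite !coefZ coefPn_prod_XsubC -?lt0n //.
have /monicP : \prod_(w <- s) ('X - w%:P) \is monic by apply: monic_prod_XsubC.
rewrite /lead_coef size_prod_XsubC /= => ->.
by rewrite mulr1 mulrN opprK mulrAC mulfV // mul1r.
Qed.

(** * Taylor polynomials with real coefficients *)

(** Real counterpart of [taylor_poly], to which Rolle's theorem and [real_poly_factor] apply. *)
Definition real_taylor (R : realType) (f : R -> R) (r : nat) (c : R) :
    {poly R} :=
  \sum_(k < r.+1) (f^`(k)%classic c / k`!%:R) *: ('X - c%:P) ^+ k.

Section RealTaylor.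
Variables (R : realType).
Implicit Types (f : R -> R) (r : nat) (a b c x : R).

Lemma taylor_polyE f r c :
  taylor_poly f r c = map_poly (real_complex R) (real_taylor f r c).
Proof.
rewrite /taylor_poly /real_taylor raddf_sum; apply: eq_bigr => k _ /=.
by rewrite map_polyZ /= rmorphXn /= map_polyXsubC.
Qed.

Lemma real_taylorS f r c :
  real_taylor f r.+1 c =
  real_taylor f r c +
  (f^`(r.+1)%classic c / (r.+1)`!%:R) *: ('X - c%:P) ^+ r.+1.
Proof. by rewrite /real_taylor big_ord_recr. Qed.

Lemma size_real_taylor f r c : (size (real_taylor f r c) <= r.+1)%N.
Proof.
apply: (leq_trans (size_sum _ _ _)); apply/bigmax_leqP => k _.
by rewrite (leq_trans (size_scale_leq _ _)) // size_exp_XsubC ltn_ord.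
Qed.

Lemma coef_real_taylor f r c :
  (real_taylor f r c)`_r = f^`(r)%classic c / r`!%:R.
Proof.
have lead n : (('X - c%:P) ^+ n)`_n = 1.
  have /monicP : ('X - c%:P) ^+ n \is monic by rewrite monic_exp ?monicXsubC.
  by rewrite /lead_coef size_exp_XsubC.
case: r => [|r].
  by rewrite /real_taylor big_ord1 coefZ lead mulr1.
rewrite real_taylorS coefD coefZ lead mulr1 nth_default ?add0r //.
exact: size_real_taylor.
Qed.

(** Two terms reach degree [r]: the one of order [r], and the one of order [r.+1] through its second
    coefficient [- (r.+1) c]. *)
Lemma coef_pred_real_taylor f r c :
  (real_taylor f r.+1 c)`_r =
  (f^`(r)%classic c - c * f^`(r.+1)%classic c) / r`!%:R.
Proof.
rewrite real_taylorS coefD coef_real_taylor coefZ.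
(* The power is the product over a constant list of roots, so its second coefficient is minus their
   sum. *)
have -> : (('X - c%:P) ^+ r.+1)`_r = - (c *+ r.+1).
  have := @coefPn_prod_XsubC R (nseq r.+1 c).
  by rewrite size_nseq !big_nseq iter_mulr_1 iter_addr_0 => ->.
rewrite factS natrM mulrBl; congr (_ + _).
have : r`!%:R != 0 :> R by rewrite pnatr_eq0 -lt0n fact_gt0.
have : r.+1%:R != 0 :> R by rewrite pnatr_eq0.
by move=> *; rewrite -mulr_natr; field; rewrite ?nat1r; apply/andP.
Qed.

Lemma deriv_real_taylor f r c :
  (real_taylor f r.+1 c)^`()%R = real_taylor (f^`()%classic) r c.
Proof.
rewrite /real_taylor raddf_sum big_ord_recl /= expr0 derivZ derivC scaler0 add0r.
apply: eq_bigr => k _; rewrite derivZ deriv_exp derivXsubC mul1r /= /bump /= add0n -derive1nS derive1Sn.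
rewrite -scalerMnr scalerMnl -mulr_natr factS natrM; congr (_ *: _).
have : k`!%:R != 0 :> R by rewrite pnatr_eq0 -lt0n fact_gt0.
have : k.+1%:R != 0 :> R by rewrite pnatr_eq0.
by move=> *; field; rewrite ?nat1r; apply/andP.
Qed.

(** * Variation of the Taylor polynomial with its centre *)

(** The derivative telescopes: by the product rule, the term of order [r.+1] contributes the claimed
    expression minus the one for order [r], which the induction hypothesis supplies. *)
Lemma is_derive_real_taylor f r x c :
  (forall k, (k <= r)%N -> derivable (f^`(k)%classic) c 1) ->
  is_derive c 1 (fun t => (real_taylor f r t).[x])
    (r`!%:R^-1 * (f^`(r.+1)%classic c * (x - c) ^+ r)).
Proof.
elim: r => [|r IHr] fd.
  have -> : (fun t => (real_taylor f 0 t).[x]) = f.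
    apply/funext => t.
    by rewrite /real_taylor big_ord1 expr0 fact0 divr1 hornerZ hornerC mulr1.
  rewrite fact0 invr1 mul1r expr0 mulr1 derive1n1 derive1E.
  by apply/derivableP; exact: (fd 0%N).
have -> : (fun t => (real_taylor f r.+1 t).[x]) =
    (fun t => (real_taylor f r t).[x]) +
    ((r.+1)`!%:R^-1 \*: (f^`(r.+1)%classic * (cst x - id) ^+ r.+1)).
  apply/funext => t; rewrite real_taylorS hornerD hornerZ horner_exp hornerXsubC.
  rewrite !fctE /= /GRing.scale /=; ring.
have D1 := IHr (fun k kr => fd k (leqW kr)).
have D2 : is_derive c 1 (f^`(r.+1)%classic) (f^`(r.+2)%classic c).
  by rewrite (derive1nS _ r.+1) derive1E; apply/derivableP; exact: fd.
apply: is_derive_eq.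
rewrite /GRing.scale /= !fctE /= factS natrM.
have : r`!%:R != 0 :> R by rewrite pnatr_eq0 -lt0n fact_gt0.
have : r.+1%:R != 0 :> R by rewrite pnatr_eq0.
by move=> *; rewrite exprS; field; rewrite ?nat1r; apply/andP.
Qed.

(* The mean value theorem on the two halves of [a, b] gives two distinct
   points, at most one of which is the zero [x] of the derivative. *)
Lemma even_derive_neq (g h : R -> R) a b x (k : R) n :
  a < b -> 0 < k -> ~~ odd n ->
  (forall c, c \in `[a, b]%R -> is_derive c 1 g (k * (h c * (x - c) ^+ n))) ->
  {within `[a, b], continuous h} ->
  (forall c, c \in `[a, b]%R -> h c != 0) ->
  g a != g b.
Proof.
move=> ab k0 n_even gd hc hn.
(* By the intermediate value theorem [h] keeps one sign; multiplying by [h a] treats both signs at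
   once. *)
have hpos t : t \in `[a, b]%R -> 0 < h a * h t.
  move=> tab; have := tab; rewrite in_itv /= => /andP[at_ tb].
  have a_in : a \in `[a, b]%R by rewrite in_itv /= lexx ltW.
  rewrite ltNge; apply/negP => ht.
  have [||c cat hc0] := @IVT R h a t 0 at_.
  - apply: continuous_subspaceW hc => y /=; rewrite !in_itv /= => /andP[-> yt].
    exact: le_trans yt tb.
  - rewrite ge_min le_max; have := hn _ a_in; move: ht.
    case: (ltgtP (h a) 0) => //= ha; first by rewrite nmulr_rle0 // => ->.
    by rewrite pmulr_rle0 // => ->.
  - move: (hn c); rewrite hc0 eqxx => H; suff: false by [].
    apply: H; move: cat; rewrite !in_itv /= => /andP[-> ct].
    exact: le_trans ct tb.
have MVTg u v : a <= u -> u < v -> v <= b -> exists2 c, c \in `]u, v[%R &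
    g v - g u = k * (h c * (x - c) ^+ n) * (v - u).
  move=> au uv vb.
  have uvab y : y \in `[u, v]%R -> y \in `[a, b]%R.
    rewrite !in_itv /= => /andP[uy yv].
    by rewrite (le_trans au uy) (le_trans yv vb).
  have gd_uv y : y \in `]u, v[%R ->
      is_derive y 1 g ((fun c => k * (h c * (x - c) ^+ n)) y).
    by move=> /subset_itv_oo_cc /uvab /gd.
  have gc : {within `[u, v], continuous g}.
    by apply: derivable_within_continuous => y /uvab /gd [].
  have [c cuv E] := MVT uv gd_uv gc.
  by exists c.
have [c1 c1am E1] := MVTg a ((a + b) / 2) ltac:(lra) ltac:(lra) ltac:(lra).
have [c2 c2mb E2] := MVTg ((a + b) / 2) b ltac:(lra) ltac:(lra) ltac:(lra).
move: c1am c2mb; rewrite !in_itv /= => /andP[ac1 c1m] /andP[mc2 c2b].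
have h1 : 0 < h a * h c1 by apply: hpos; rewrite in_itv /=; lra.
have h2 : 0 < h a * h c2 by apply: hpos; rewrite in_itv /=; lra.
have u1 : 0 <= (x - c1) ^+ n by apply: exprn_even_ge0.
have u2 : 0 <= (x - c2) ^+ n by apply: exprn_even_ge0.
(* The midpoint separates [c1] from [c2], so [x] cannot equal both; for [n = 0] both powers are
   1. *)
have u12 : 0 < (x - c1) ^+ n + (x - c2) ^+ n.
  rewrite lt_def addr_ge0 // paddr_eq0 // !expf_eq0 andbT negb_and !negb_and.
  case: (x - c1 =P 0) => [e1|_]; last by rewrite !orbT.
  have -> : (x - c2 == 0) = false by apply/eqP => e2; lra.
  by rewrite !orbT.
apply/eqP => gab.
(* If [g a = g b], the increments over the two halves, which have equal length, cancel; multiplied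
   by [h a] they are nonnegative, so both powers vanish, against [u12]. *)
have : (h a * h c1) * (x - c1) ^+ n + (h a * h c2) * (x - c2) ^+ n = 0.
  have kab : k * (b - a) != 0 by rewrite mulf_neq0 //; lra.
  apply: (mulfI kab); rewrite mulr0.
  have : h a * (g ((a + b) / 2) - g a) + h a * (g b - g ((a + b) / 2)) = 0.
    by rewrite gab; ring.
  rewrite E1 E2 => E; rewrite -[RHS](mulr0 2) -[in RHS]E; by field.
move/eqP; rewrite (paddr_eq0 (mulr_ge0 (ltW h1) u1) (mulr_ge0 (ltW h2) u2)).
rewrite (mulf_eq0 (h a * h c1)) (mulf_eq0 (h a * h c2)).
rewrite (gt_eqF h1) (gt_eqF h2) /=.
by move=> /andP[/eqP e1 /eqP e2]; rewrite e1 e2 addr0 ltxx in u12.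
Qed.

(** * Integrals from antiderivatives *)

Lemma derivable_LRcontinuous (F : R -> R) a b : a < b ->
  (forall c, c \in `[a, b]%R -> derivable F c 1) ->
  derivable_oo_LRcontinuous F a b.
Proof.
move=> ab Fd.
have Fc c : c \in `[a, b]%R -> F t @[t --> c] --> F c.
  by move=> /Fd /derivable1_diffP /differentiable_continuous.
split.
- by move=> c /subset_itv_oo_cc /Fd.
- by apply: cvg_at_right_filter; apply: Fc; rewrite in_itv /= lexx ltW.
- by apply: cvg_at_left_filter; apply: Fc; rewrite in_itv /= lexx ltW.
Qed.

Lemma Rintegral_derive (F g : R -> R) a b : a < b ->
  (forall c, c \in `[a, b]%R -> is_derive c 1 F (g c)) ->
  {within `[a, b], continuous g} ->
  \int[lebesgue_measure]_(t in `[a, b]) g t = F b - F a.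
Proof.
move=> ab Fd gc; rewrite /Rintegral (continuous_FTC2 ab gc (F := F)) //.
  by apply: derivable_LRcontinuous => // c /Fd [].
by move=> c /subset_itv_oo_cc /Fd ?; rewrite derive1E derive_val.
Qed.

(** * Degree, leading coefficients and real zeros of the difference *)

Section Difference.
Variables (f : R -> R) (a b : R) (r : nat).
Hypothesis ab : a < b.
Hypothesis fd : forall k c, (k <= r)%N -> c \in `[a, b]%R ->
  derivable (f^`(k)%classic) c 1.
Hypothesis fc : {within `[a, b], continuous (f^`(r.+1)%classic)}.
Hypothesis fn : forall c, c \in `[a, b]%R -> f^`(r.+1)%classic c != 0.

Let P := real_taylor f r b - real_taylor f r a.

Lemma derive_last c : c \in `[a, b]%R ->
  is_derive c 1 (f^`(r)%classic) (f^`(r.+1)%classic c).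
Proof.
by move=> cab; rewrite derive1nS derive1E; apply/derivableP; exact: fd.
Qed.

Lemma taylor_diff_no_real_root x : ~~ odd r -> ~~ root P x.
Proof.
move=> er; rewrite rootE hornerD hornerN subr_eq0 eq_sym.
have k0 : 0 < r`!%:R^-1 :> R by rewrite invr_gt0 ltr0n fact_gt0.
apply: (@even_derive_neq (fun c => (real_taylor f r c).[x]) (f^`(r.+1)%classic)
  a b x _ r ab k0 er _ fc fn) => c cab.
by apply: is_derive_real_taylor => k kr; exact: fd.
Qed.

(** The case of exponent 0 in [even_derive_neq], where the point [x] is arbitrary. It yields both
    that the difference has degree exactly [r] and that the integral of [f^(r+1)] is nonzero. *)
Lemma last_derivative_neq : f^`(r)%classic a != f^`(r)%classic b.
Proof.
apply: (@even_derive_neq (f^`(r)%classic) (f^`(r.+1)%classic) a b 0 1 0 ab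
  ltr01 isT _ fc fn) => c cab.
by rewrite expr0 mulr1 mul1r; exact: derive_last.
Qed.

Lemma size_taylor_diff : size P = r.+1.
Proof.
apply/anti_leq/andP; split.
  rewrite (leq_trans (size_polyD _ _)) // geq_max size_polyN.
  by rewrite !size_real_taylor.
apply: contraTltn (last_derivative_neq) => /leq_sizeP /(_ r (leqnn r)) /eqP.
rewrite /P coefB !coef_real_taylor -mulrBl mulf_eq0 invr_eq0 pnatr_eq0.
by rewrite -[r`! == 0%N]negbK -lt0n fact_gt0 orbF subr_eq0 eq_sym negbK.
Qed.

Lemma coef_taylor_diff :
  P`_r = (\int[lebesgue_measure]_(t in `[a, b]) f^`(r.+1)%classic t) / r`!%:R.
Proof.
rewrite (Rintegral_derive ab derive_last fc).
by rewrite coefB !coef_real_taylor mulrBl.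
Qed.

(** Integration by parts: [t f^(r)(t) - f^(r-1)(t)] is an antiderivative of [t f^(r+1)(t)], and its
    value at the centre is, up to sign and factorial, the coefficient of degree [r.-1]. *)
Lemma coef_pred_taylor_diff : (0 < r)%N ->
  P`_r.-1 = - (\int[lebesgue_measure]_(t in `[a, b])
    (t * f^`(r.+1)%classic t)) / (r.-1)`!%:R.
Proof.
move=> r0; have D c : c \in `[a, b]%R ->
    is_derive c 1 (id * f^`(r)%classic - f^`(r.-1)%classic)
      (c * f^`(r.+1)%classic c).
  move=> cab; have D1 := derive_last cab.
  have D2 : is_derive c 1 (f^`(r.-1)%classic) (f^`(r)%classic c).
    rewrite -[in X in is_derive _ _ _ X](prednK r0) derive1nS derive1E.
    by apply/derivableP; apply: fd => //; exact: leq_pred.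
  apply: is_derive_eq; rewrite /GRing.scale /=; ring.
have C : {within `[a, b], continuous (fun t => t * f^`(r.+1)%classic t)}.
  move=> t; apply: continuousM; last exact: fc.
  by move: t; apply: continuous_subspaceT => y; exact: cvg_id.
rewrite (Rintegral_derive ab D C) !fctE coefB /P.
by case: r r0 => // n _; rewrite !coef_pred_real_taylor /=; ring.
Qed.

(** The factorials leave [r! / (r-1)! = r], which the division by [r] cancels. *)
Lemma taylor_diff_barycenter : (0 < r)%N ->
  - P`_r.-1 / P`_r / r%:R =
  (\int[lebesgue_measure]_(t in `[a, b]) (t * f^`(r.+1)%classic t)) /
  (\int[lebesgue_measure]_(t in `[a, b]) f^`(r.+1)%classic t).
Proof.
move=> r0; have : \int[lebesgue_measure]_(t in `[a, b]) f^`(r.+1)%classic t != 0.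
  rewrite (Rintegral_derive ab derive_last fc) subr_eq0 eq_sym.
  exact: last_derivative_neq.
rewrite coef_taylor_diff coef_pred_taylor_diff //.
rewrite -[in r`!](prednK r0) factS (prednK r0) natrM.
have : r%:R != 0 :> R by rewrite pnatr_eq0 -lt0n.
have : (r.-1)`!%:R != 0 :> R by rewrite pnatr_eq0 -lt0n fact_gt0.
by move=> f0 rn i0; field; rewrite f0 rn i0.
Qed.

End Difference.

Lemma deriv_taylor_diff_no_real_root f a b r x : a < b ->
  (forall k c, (k <= r)%N -> c \in `[a, b]%R ->
    derivable (f^`(k)%classic) c 1) ->
  {within `[a, b], continuous (f^`(r.+1)%classic)} ->
  (forall c, c \in `[a, b]%R -> f^`(r.+1)%classic c != 0) ->
  odd r ->
  ~~ root ((real_taylor f r b - real_taylor f r a)^`()%R) x.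
Proof.
case: r => // r ab fd fc fn rodd; rewrite derivB !deriv_real_taylor.
apply: taylor_diff_no_real_root => //.
- by move=> k c kr cab; rewrite -derive1Sn; exact: fd.
- by rewrite -derive1Sn.
- by move=> c cab; rewrite -derive1Sn; exact: fn.
Qed.

End RealTaylor.

(** * Counting the zeros and computing their mean *)

Theorem proposition2 (R : realType) (a b : R) (r : nat) (f : R -> R) (J : set R)
    (a_gt0 : 0 < a) (a_lt_b : a < b) (r_gt0 : (0 < r)%N)
    (J_open : open J) (J_itv : is_interval J) (ab_sub_J : `[a, b] `<=` J)
    (f_der : forall (k : nat) (x : R), (k <= r)%N -> J x ->
       derivable (f^`(k)%classic) x 1)
    (f_cont : {within J, continuous (f^`(r.+1)%classic)})
    (f_neq0 : forall x : R, `[a, b] x -> f^`(r.+1)%classic x != 0) :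
  let P := taylor_poly f r b - taylor_poly f r a in
  let m := (\int[lebesgue_measure]_(t in `[a, b]) (t * f^`(r.+1)%classic t)) /
           (\int[lebesgue_measure]_(t in `[a, b]) (f^`(r.+1)%classic t)) in
  (odd r ->
     let s := ((r - 1) %/ 2)%N in
     exists (x0 : R) (z : 'I_s -> R[i]),
       [/\ forall x : R, root P x%:C <-> x = x0,
           forall k : 'I_s, complex.Im (z k) != 0,
           zeros_with_multiplicity P (x0%:C :: conj_pairs z)
         & (x0 + \sum_(k < s) 2 * complex.Re (z k)) / r%:R = m])
  /\
  (~~ odd r ->
     let s := (r %/ 2)%N in
     exists z : 'I_s -> R[i],
       [/\ forall x : R, ~~ root P x%:C,
           forall k : 'I_s, complex.Im (z k) != 0,
           zeros_with_multiplicity P (conj_pairs z)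
         & (\sum_(k < s) 2 * complex.Re (z k)) / r%:R = m]).
Proof.
move=> P m.
have fd k c : (k <= r)%N -> c \in `[a, b]%R -> derivable (f^`(k)%classic) c 1.
  by move=> kr cab; apply: f_der => //; apply: ab_sub_J.
have fc := continuous_subspaceW ab_sub_J f_cont.
have fn c : c \in `[a, b]%R -> f^`(r.+1)%classic c != 0 by exact: f_neq0.
pose p := real_taylor f r b - real_taylor f r a.
have PE : P = map_poly (real_complex R) p by rewrite rmorphB /= -!taylor_polyE.
have sp : size p = r.+1 := size_taylor_diff a_lt_b fd fc fn.
have p0 : p != 0 by rewrite -size_poly_gt0 sp.
have root_real x : root P x%:C = root p x by rewrite PE fmorph_root.
have [xs [h [hI pE]]] := real_poly_factor p0.
set rs := _ ++ _ in pE.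
have l0 : (lead_coef p)%:C != 0 by rewrite fmorph_eq0 lead_coef_eq0.
have PZ : zeros_with_multiplicity P rs.
  split; first by rewrite PE map_poly_eq0.
  move=> w; rewrite PE pE -mul_polyC mupMr ?rootC // mu_prod_XsubC //.
have srs : size rs = r.
  have := size_map_poly (real_complex R) p.
  by rewrite sp pE size_scale // size_prod_XsubC => -[].
have srs2 : r = (size xs + (size h).*2)%N.
  by rewrite -srs size_cat size_map size_with_conj.
(* Vieta over the complex numbers; conjugate pairs have real sums, so the identity descends to the
   reals. *)
have sum_rs : (\sum_(x <- xs) x + \sum_(z <- h) 2 * complex.Re z) / r%:R = m.
  rewrite /m -(taylor_diff_barycenter a_lt_b fd fc fn r_gt0) -/p; congr (_ / _).
  have : (0 < size rs)%N by rewrite srs.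
  move=> /Vieta_sum_roots /(_ l0 pE).
  rewrite srs !coef_map /= big_cat big_map /= sum_with_conj.
  by rewrite -raddf_sum -fmorphV -rmorphN -rmorphM -rmorphD => /complexI.
have root_xs x : root p x -> x \in xs.
  rewrite -root_real PE pE rootZ // root_prod_XsubC mem_cat => /orP[|].
    by rewrite (mem_map (@complexI R)).
  by move=> /(mem_with_conj_Im hI); rewrite /= eqxx.
have xs_root x : x \in xs -> root p x.
  move=> xxs; rewrite -root_real PE pE rootZ // root_prod_XsubC mem_cat.
  by rewrite (mem_map (@complexI R)) xxs.
have hIn s (k : 'I_s) : size h = s -> complex.Im (h`_k) != 0.
  by move=> hs; apply: (allP hI); rewrite mem_nth // hs.
have sumE s : size h = s ->
    \sum_(k < s) 2 * complex.Re h`_k = \sum_(z <- h) 2 * complex.Re z.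
  by move=> <-; rewrite (big_nth 0) big_mkord.
split=> rodd s.
- have droot x : ~~ root p^`()%R x.
    exact: deriv_taylor_diff_no_real_root a_lt_b fd fc fn rodd.
  have [x0 xsE] : exists x0, xs = [:: x0].
    (* No real root would make [r] twice the size of [h], hence even. Two distinct ones give a zero
       of the derivative by Rolle. *)
    case: xs @rs pE PZ srs srs2 sum_rs root_xs xs_root
      => [|x [|y t]] rs pE PZ srs srs2 sum_rs root_xs xs_root.
    + by move: rodd; rewrite srs2 add0n odd_double.
    + by exists x.
    + have [xy|xy] := eqVneq x y; last first.
        have no_rolle u v : root p u -> root p v -> u < v -> False.
          move=> /rootP pu /rootP pv uv.
          have [w _ /rootP pw] := polyrcf.poly_rolle uv (etrans pu (esym pv)).
          by move: (droot w); rewrite pw.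
        have px : root p x by apply: xs_root; rewrite mem_head.
        have py : root p y by apply: xs_root; rewrite !inE eqxx orbT.
        by case: (ltgtP x y) xy => // [/(no_rolle _ _ px py)|/(no_rolle _ _ py px)].
      (* A repeated entry makes [x] a double zero, hence a zero of the derivative. *)
      have := droot x; rewrite -(fmorph_root (real_complex R)) -deriv_map pE.
      rewrite /= !big_cons -xy derivZ rootZ // rootE !derivM derivXsubC.
      by rewrite !(hornerE, hornerXsubC) subrr !(mul0r, mulr0, addr0) eqxx.
  subst xs.
  have hs : size h = s by rewrite /s srs2 addnC addnK -muln2 mulnK.
  exists x0, (fun k => h`_k); split => [x|k||].
  + rewrite root_real; split=> [/root_xs|->]; first by rewrite inE => /eqP.
    by apply: xs_root; rewrite mem_head.
  + exact: hIn.
  + by rewrite conj_pairs_nth.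
  + by rewrite sumE // -sum_rs big_seq1.
- have noroot x : ~~ root p x := taylor_diff_no_real_root a_lt_b fd fc fn x rodd.
  have xs0 : xs = [::].
    case: xs xs_root {pE rs PZ srs srs2 sum_rs root_xs} => // x xs /(_ x).
    by rewrite mem_head (negbTE (noroot x)) => /(_ isT).
  subst xs.
  have hs : size h = s by rewrite /s srs2 /= add0n -muln2 mulnK.
  exists (fun k => h`_k); split => [x|k||].
  + by rewrite root_real.
  + exact: hIn.
  + by rewrite conj_pairs_nth.
  + by rewrite sumE // -sum_rs big_nil add0r.
Qed.
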